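(* Let $I$ be an arbitrary index set and let $D_i f=g_i$ $(i\in I)$ be a system of difference equations in which every difference operator consists of at most two terms; that is, for every $i\in I$ there are real numbers $a_i^{(1)},a_i^{(2)},b_i^{(1)},b_i^{(2)}$ such that the $i$-th equation is $$a_i^{(1)} f\left(x+b_i^{(1)}\right)+a_i^{(2)} f\left(x+b_i^{(2)}\right)=g_i(x)\qquad(x\in\mathbb{R}),$$ where $g_i:\mathbb{R}\to\mathbb{R}$ is a given function. If every countable subsystem has a Baire class $1$ solution, then the whole system has a Baire class $1$ solution.
   Context: A function $f:\mathbb{R}\to\mathbb{R}$ is Baire class $1$ if it is the pointwise limit of a sequence of continuous functions $\mathbb{R}\to\mathbb{R}$ (in particular continuous functions are Baire class $1$). A difference operator is a map $D$ on the set of functions $\mathbb{R}\to\mathbb{R}$ of the form $(Df)(x)=\sum_{i=1}^n a_i f(x+b_i)$ with $a_i,b_i\in\mathbb{R}$. A solution to a system (or subsystem) is a single function $f:\mathbb{R}\to\mathbb{R}$ satisfying all its equations for all $x\in\mathbb{R}$; a subsystem is given by a subset of the equations. *)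

(* Defs.v *)
From mathcomp Require Import all_boot all_order all_algebra.
From mathcomp Require Import all_classical all_reals all_analysis.

Set Implicit Arguments.
Unset Strict Implicit.
Unset Printing Implicit Defensive.

Import numFieldNormedType.Exports.
Local Open Scope classical_set_scope.
Local Open Scope ring_scope.

Definition baire_class1 (R : realType) (f : R -> R) : Prop :=
  exists F : nat -> R -> R,
    (forall n, continuous (F n)) /\ (forall x, F n x @[n --> \oo] --> f x).

(* [D] is a difference operator with at most two terms: zero coefficients and
   equal shifts are allowed. *)
Definition two_term_difference_operator (R : realType)
    (D : (R -> R) -> (R -> R)) : Prop :=
  exists a1 a2 b1 b2 : R,
    forall (f : R -> R) (x : R), D f x = a1 * f (x + b1) + a2 * f (x + b2).

(* [f] satisfies the subsystem formed by the equations [D i f = g i], [i] in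
   [J]; the whole system is the case [J = setT]. *)
Definition solves (R : realType) (I : Type) (D : I -> (R -> R) -> (R -> R))
    (g : I -> R -> R) (J : set I) (f : R -> R) : Prop :=
  forall i, J i -> forall x : R, D i f x = g i x.

(* Main.v *)
Require Import Defs.
From mathcomp Require Import all_boot all_order all_algebra.
From mathcomp Require Import all_classical all_reals all_analysis.
From mathcomp Require Import ring lra.

Import Order.TTheory GRing.Theory Num.Theory.
Import numFieldNormedType.Exports.
Local Open Scope classical_set_scope.
Local Open Scope ring_scope.

(** The obstruction to passing from countable subsystems to the whole system is
    the freedom left by a countable subsystem, that is, its homogeneous
    Baire class 1 solutions.  If some countable subsystem has only one
    Baire class 1 solution [f], adding any single equation to it cannot change
    the solution, so [f] solves everything.

    Otherwise no equation can determine its solution, and then the homogeneous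
    form of every equation [i] is [h (x + b_i) = c_i * h x] with [c_i != 0]
    ([two_term_kernel]).  Two situations remain.

    - Some differences [b_i - b_j] are positive and arbitrarily small.
      Countably many equations witness this, and a homogeneous solution [h] of
      these is multiplied by constants under a dense group of shifts.  Such an
      [h] vanishes identically as soon as it vanishes at one of its continuity
      points ([eq0_of_zero_continuity_point]).  Two Baire class 1 functions
      have a common continuity point by the Baire category theorem, so the
      Baire class 1 homogeneous solutions form a space of dimension at most
      one ([proportional_of_common_shifts]).  Since the subsystem enlarged by
      an equation [i] still has two solutions, that one-dimensional space
      consists of homogeneous solutions of [i] too, and any solution of the
      countable subsystem solves [i].

    - The values [b_i] are uniformly separated, so there are only countably
      many of them.  Two equations with the same shift have the same
      multiplier, because they have a common nonzero homogeneous solution;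
      hence solving one equation for each value of the shift suffices. *)

(** * Continuity points of Baire class 1 functions *)

(** If the union of the interiors missed a nonempty open set [V], every [A n]
    would be nowhere dense in [V].  Adding the complement of [closure V] to the
    complements of the [A n] makes them dense in the whole space, and the Baire
    category theorem then gives a point of [V] lying in no [A n]. *)
Lemma dense_bigcup_interior {K : realType} (U : completeNormedModType K)
    (A : nat -> set U) :
  (forall n, closed (A n)) -> (forall x, exists n, A n x) ->
  dense (\bigcup_n (A n)°).
Proof.
move=> clA covA; apply: contrapT => /denseNE[V [[z [oV Vz]] V0]].
pose G n := ~` A n `|` ~` closure V.
have GB n : open (G n) /\ dense (G n).
  split; first by apply: openU; apply: closed_openC => //; exact: closed_closure.
  move=> W [w Ww] oW; apply: contrapT => WG.
  have WA : W `<=` A n.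
    by move=> y Wy; apply: contrapT => nAy; apply: WG; exists y; split=> //; left.
  have WV : W `<=` closure V.
    by move=> y Wy; apply: contrapT => nVy; apply: WG; exists y; split=> //; right.
  have [y [Vy Wy]] := WV _ Ww W (open_nbhs_nbhs (conj oW Ww)).
  suff : (V `&` \bigcup_n (A n)°) y by rewrite V0.
  split=> //; exists n => //.
  by move: y Wy {Vy}; rewrite -/(W `<=` (A n)°) -open_subsetE.
have [y [Vy Gy]] := Baire GB (ex_intro _ z Vz) oV.
have [n Any] := covA y.
by case: (Gy n I) => //; apply; exact: subset_closure.
Qed.

(** Write [f] as the limit of continuous [F n].  The closed sets [A N] where the
    [F n] with [n >= N] are [e / 4]-close to each other cover the line, and on
    the interior of [A N] the function [f] is [e / 4]-close to the continuous
    function [F N]. *)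
Lemma baire_class1_small_oscillation {R : realType} {f : R -> R} {e : R} :
  baire_class1 f -> 0 < e ->
  exists U : set R, [/\ open U, dense U &
    forall x, U x -> \forall y \near x, `|f x - f y| < e].
Proof.
move=> [F [cF Ff]] e0.
have e4 : 0 < e / 4 by lra.
pose A N := [set x | forall m n, (N <= m)%N -> (N <= n)%N ->
  `|F m x - F n x| <= e / 4].
have clA N : closed (A N).
  have -> : A N = \bigcap_(p in [set p : nat * nat | (N <= p.1)%N /\ (N <= p.2)%N])
      ((fun x => `|F p.1 x - F p.2 x|) @^-1` [set r | r <= e / 4]).
    apply/seteqP; split=> x /=; first by move=> Ax [m n] /= [Nm Nn]; exact: Ax.
    by move=> Ax m n Nm Nn; apply: (Ax (m, n)).
  apply: closed_bigI => p _; apply: preimage_closed; last exact: closed_le.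
  by move=> x _; apply: cvg_norm; apply: cvgB; exact: cF.
have covA x : exists N, A N x.
  have e8 : 0 < e / 8 by lra.
  have [N _ HN] := (cvgrPdist_lt _ _).1 (Ff x) _ e8.
  exists N => m n /HN /= hm /HN /= hn.
  rewrite (_ : _ - _ = (f x - F n x) - (f x - F m x)); last by ring.
  by apply: le_trans (ler_normB _ _) _; lra.
exists (\bigcup_n (A n)°); split.
- by apply: bigcup_open => n _; exact: open_interior.
- exact: dense_bigcup_interior.
move=> x [N _ AxN].
have fF y : A N y -> `|F N y - f y| <= e / 4.
  move=> Ay; apply: (@closed_cvg _ _ \oo _ (fun n => `|F N y - F n y|)
    [set r : R | r <= e / 4]); [exact: closed_le| |].
    by exists N => // n /= Nn; exact: Ay.
  by apply: cvg_norm; apply: cvgB; [exact: cvg_cst|exact: Ff].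
have Ax := fF x (interior_subset AxN).
have cN := (cvgrPdist_lt _ _).1 (cF N x) _ e4.
near=> y.
have Ay : `|F N y - f y| <= e / 4 by apply: fF; near: y; exact: AxN.
have FN : `|F N x - F N y| < e / 4 by near: y; exact: cN.
rewrite (_ : _ - _ = (F N x - F N y) + ((F N y - f y) - (F N x - f x))); last by ring.
apply: le_lt_trans (ler_normD _ _) _.
have := ler_normB (F N y - f y) (F N x - f x).
by lra.
Unshelve. all: by end_near. Qed.

(** The continuity points of a Baire class 1 function form a residual set, and
    two residual sets meet. *)
Lemma baire_class1_common_continuity_point {R : realType} {f g : R -> R} :
  baire_class1 f -> baire_class1 g ->
  exists x, {for x, continuous f} /\ {for x, continuous g}.
Proof.
move=> Bf Bg.
have n0 n : 0 < n.+1%:R^-1 :> R by rewrite invr_gt0.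
have [U HU] := choice (fun n => baire_class1_small_oscillation Bf (n0 n)).
have [V HV] := choice (fun n => baire_class1_small_oscillation Bg (n0 n)).
have UVB n : open (U n `&` V n) /\ dense (U n `&` V n).
  have [[oU dU _] [oV dV _]] := (HU n, HV n).
  by split; [exact: openI|exact: denseI].
have [x [_ UVx]] := @Baire R R _ UVB setT (ex_intro _ 0 I) openT.
exists x; split; apply/cvgrPdist_lt => e e0.
  have [N _ HN] := near_infty_natSinv_lt (PosNum e0).
  have [_ _ /(_ x (UVx N I).1) H] := HU N.
  by apply: filterS H => y /lt_trans; apply; exact: (HN N (leqnn N)).
have [N _ HN] := near_infty_natSinv_lt (PosNum e0).
have [_ _ /(_ x (UVx N I).2) H] := HV N.
by apply: filterS H => y /lt_trans; apply; exact: (HN N (leqnn N)).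
Qed.

Lemma baire_class1B {R : realType} (f g : R -> R) :
  baire_class1 f -> baire_class1 g -> baire_class1 (f - g).
Proof.
move=> [F [cF Ff]] [G [cG Gg]]; exists (fun n => F n - G n); split=> [n x|x].
  by apply: cvgB; [exact: cF|exact: cG].
by apply: cvgB; [exact: Ff|exact: Gg].
Qed.

(** * Functions multiplied by constants under a dense group of shifts *)

Definition multiplicative_shift {R : realType} (h : R -> R) (b c : R) :=
  c != 0 /\ forall x, h (x + b) = c * h x.

Lemma multiplicative_shiftD {R : realType} {h : R -> R} {b c b' c' : R} :
  multiplicative_shift h b c -> multiplicative_shift h b' c' ->
  multiplicative_shift h (b + b') (c * c').
Proof.
move=> [c0 hb] [c'0 hb']; split=> [|x]; first by rewrite mulf_neq0.
by rewrite [b + b']addrC addrA hb hb' mulrA.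
Qed.

Lemma multiplicative_shiftN {R : realType} {h : R -> R} {b c : R} :
  multiplicative_shift h b c -> multiplicative_shift h (- b) c^-1.
Proof.
move=> [c0 hb]; split=> [|x]; first by rewrite invr_neq0.
by rewrite -[x in RHS](subrK b) hb mulKf.
Qed.

Lemma multiplicative_shiftMz {R : realType} {h : R -> R} {b c : R} (n : int) :
  multiplicative_shift h b c -> multiplicative_shift h (b *~ n) (c ^ n).
Proof.
move=> hb.
have hn (k : nat) : multiplicative_shift h (b *+ k) (c ^+ k).
  elim: k => [|k IH]; last by rewrite mulrS exprS; exact: multiplicative_shiftD.
  by split=> [|x]; rewrite ?oner_neq0 // mulr0n addr0 mul1r.
by case: n => k; [exact: hn|exact: multiplicative_shiftN (hn k.+1)].
Qed.

Definition has_small_multiplicative_shifts {R : realType} (h : R -> R) :=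
  forall e : R, 0 < e ->
    exists b c, 0 < b < e /\ multiplicative_shift h b c.

(** The admissible shifts form a group, and a group of reals with arbitrarily
    small positive elements is dense. *)
Lemma multiplicative_shifts_dense {R : realType} {h : R -> R} (t : R) {e : R} :
  has_small_multiplicative_shifts h -> 0 < e ->
  exists b c, `|b - t| < e /\ multiplicative_shift h b c.
Proof.
move=> sh e0; have [d [c [/andP[d0 de] hd]]] := sh e e0.
exists (d *~ Num.floor (t / d)), (c ^ Num.floor (t / d)).
split; last exact: multiplicative_shiftMz.
have /andP[] := floor_itv (t / d).
rewrite ler_pdivlMr // ltr_pdivrMr // intrD mulrDl mul1r ![_%:~R * d]mulrC !mulrzr => h1 h2.
by rewrite ltr_norml; move: h1 h2; set u := _ *~ _ => h1 h2; lra.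
Qed.

(** Suppose [h y != 0].  Near [x0] the values [h (y + b) = c * h y] are small, so
    multipliers of shifts [b] close to [x0 - y] are small.  Take one such
    shift [b], with multiplier [c], and a second one [b'] whose multiplier [c']
    is smaller than [c ^+ 2].  Then [b + b - b'] is still close to [x0 - y], but
    its multiplier [c ^+ 2 / c'] exceeds 1 in absolute value. *)
Lemma eq0_of_zero_continuity_point {R : realType} {h : R -> R} {x0 : R} :
  has_small_multiplicative_shifts h ->
  {for x0, continuous h} -> h x0 = 0 -> forall y, h y = 0.
Proof.
move=> sh ch h0 y; apply/eqP/negPn/negP => hy0.
have hyp : 0 < `|h y| by rewrite normr_gt0.
have small e : 0 < e -> exists2 d, 0 < d & forall x, `|x0 - x| < d -> `|h x| < e.
  move=> e0; have H : nbhs x0 [set x | `|h x0 - h x| < e].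
    exact: (cvgrPdist_lt _ _).1 ch _ e0.
  have [d d0 Hd] := (nbhs_ballP _ _).1 H; exists d => // x xd.
  by have := Hd x xd; rewrite /= h0 sub0r normrN.
(* A third of the radius leaves room for the combination [b + b - b']. *)
have [d d0 Hd] := small _ hyp.
have [|b [c [bd [c0 hb]]]] := multiplicative_shifts_dense (x0 - y) sh (e := d / 3).
  by lra.
have c2 : 0 < `|c| ^+ 2 * `|h y| by rewrite mulr_gt0 // exprn_gt0 // normr_gt0.
have [d' d'0 Hd'] := small _ c2.
have [|b' [c' [bd' mb']]] :=
    multiplicative_shifts_dense (x0 - y) sh (e := Num.min d' (d / 3)).
  by rewrite lt_min d'0 /=; lra.
have [c'0 hb'] := mb'.
have mb : multiplicative_shift h b c by [].
have [_ hz] := multiplicative_shiftD (multiplicative_shiftD mb mb)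
  (multiplicative_shiftN mb').
move: bd'; rewrite lt_min => /andP[bd'1 bd'2].
have small_b' : `|c'| < `|c| ^+ 2.
  rewrite -(ltr_pM2r hyp) -normrM -hb'; apply: Hd'.
  by rewrite distrC (_ : _ - _ = b' - (x0 - y)) //; ring.
have : `|h (y + (b + b - b'))| < `|h y|.
  apply: Hd; move: bd bd'2; rewrite !ltr_norml => /andP[? ?] /andP[? ?].
  by apply/andP; split; lra.
rewrite hz normrM gtr_pMl // normrM normfV normrM -expr2.
by rewrite ltr_pdivrMr ?normr_gt0 // mul1r ltNge (ltW small_b').
Qed.

(** At a common continuity point [x0] one has [k x0 != 0], so some combination
    [h - l * k] vanishes at [x0]; it has the same shifts, hence it is zero. *)
Lemma proportional_of_common_shifts {R : realType} {h k : R -> R} :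
  baire_class1 h -> baire_class1 k ->
  (forall e : R, 0 < e -> exists b c, 0 < b < e /\
    (multiplicative_shift h b c /\ multiplicative_shift k b c)) ->
  (exists y, k y != 0) -> exists l, forall x, h x = l * k x.
Proof.
move=> Bh Bk sh [y ky].
have [x0 [ch ck]] := baire_class1_common_continuity_point Bh Bk.
have kx0 : k x0 != 0.
  apply: contra ky => /eqP kx0; apply/eqP.
  apply: eq0_of_zero_continuity_point kx0 _ => // e /sh[b [c [be [_ kb]]]].
  by exists b, c.
pose l := h x0 / k x0; exists l => x; apply/eqP; rewrite -subr_eq0; apply/eqP.
apply: (@eq0_of_zero_continuity_point _ (fun x => h x - l * k x) x0).
- move=> e /sh[b [c [be [[c0 hb] [_ kb]]]]]; exists b, c; split=> //; split=> // z.
  by rewrite hb kb; ring.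
- apply: cvgB; first exact: ch.
  by apply: cvgM; [exact: cvg_cst|exact: ck].
- by rewrite /l divfK // subrr.
Qed.

(** * Two-term difference operators *)

Lemma two_termB {R : realType} (D : (R -> R) -> (R -> R)) (f h : R -> R) x :
  two_term_difference_operator D -> D (f - h) x = D f x - D h x.
Proof.
move=> [a1 [a2 [b1 [b2 DE]]]]; rewrite !DE.
by rewrite (_ : (f - h) (x + b1) = f (x + b1) - h (x + b1)) //
  (_ : (f - h) (x + b2) = f (x + b2) - h (x + b2)) //; ring.
Qed.

Lemma two_termZ {R : realType} (D : (R -> R) -> (R -> R)) l (h : R -> R) x :
  two_term_difference_operator D -> D (fun y => l * h y) x = l * D h x.
Proof. by move=> [a1 [a2 [b1 [b2 DE]]]]; rewrite !DE; ring. Qed.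

(** When both coefficients vanish the kernel is everything, which the shift
    [(0, 1)] expresses; when exactly one vanishes the kernel is zero.  Equal shifts
    [b1 = b2] give a multiplicative shift by 0, which encodes no condition if
    its multiplier is 1 and [h = 0] otherwise. *)
Lemma two_term_kernel {R : realType} {D : (R -> R) -> (R -> R)} :
  two_term_difference_operator D ->
  (forall h, (forall x, D h x = 0) -> forall x, h x = 0) \/
  exists bc : R * R, forall h,
    (forall x, D h x = 0) <-> multiplicative_shift h bc.1 bc.2.
Proof.
move=> [a1 [a2 [b1 [b2 DE]]]].
have [a10|a10] := eqVneq a1 0; have [a20|a20] := eqVneq a2 0.
- right; exists (0, 1) => h; split=> [_|_ x]; last by rewrite DE a10 a20; ring.
  by split=> [|x] /=; rewrite ?oner_neq0 // addr0 mul1r.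
- left=> h h0 x; have := h0 (x - b2); rewrite DE a10 mul0r add0r subrK => /eqP.
  by rewrite mulf_eq0 (negPf a20) => /eqP.
- left=> h h0 x; have := h0 (x - b1); rewrite DE a20 mul0r addr0 subrK => /eqP.
  by rewrite mulf_eq0 (negPf a10) => /eqP.
right; exists (b1 - b2, - a2 / a1) => h; split=> /= [h0|[_ hb] x].
  split=> [|x]; first by rewrite mulf_neq0 ?oppr_eq0 ?invr_eq0.
  have := h0 (x - b2); rewrite DE subrK (_ : x - b2 + b1 = x + (b1 - b2)); last by ring.
  move=> /eqP; rewrite addr_eq0 => /eqP E.
  by apply: (mulfI a10); rewrite E; field.
rewrite DE (_ : x + b1 = (x + b2) + (b1 - b2)); last by ring.
by rewrite hb; field.
Qed.

(** * From countable subsystems to the whole system *)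

Lemma countable_setU {T : Type} {A B : set T} :
  countable A -> countable B -> countable (A `|` B).
Proof.
move=> cA cB.
have -> : A `|` B = \bigcup_(b in [set: bool]) (if b then A else B).
  apply/seteqP; split=> x; first by case=> ?; [exists true|exists false].
  by case=> -[] _ ?; [left|right].
by apply: bigcup_countable; [exact: countableP|case].
Qed.

Lemma countable_range {T : countType} {U : Type} (f : T -> U) :
  countable (range f).
Proof. exact: card_le_trans (card_image_le _ _) (countableP _). Qed.

Theorem theorem7p4 (R : realType) (I : Type)
    (D : I -> (R -> R) -> (R -> R)) (g : I -> R -> R)
    (hD : forall i, two_term_difference_operator (D i))
    (hJ : forall J : set I, countable J ->
      exists f : R -> R, baire_class1 f /\ solves D g J f) :
  exists f : R -> R, baire_class1 f /\ solves D g setT f.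
Proof.
have DB J f f' i : solves D g J f -> solves D g J f' -> J i ->
    forall x, D i (f - f') x = 0.
  by move=> sf sf' Ji x; rewrite two_termB // sf // sf' // subrr.
have transfer f f' i : (forall x, D i f x = g i x) ->
    (forall x, D i (f' - f) x = 0) -> forall x, D i f' x = g i x.
  move=> sf e x; apply/eqP; rewrite -subr_eq0 -sf -two_termB //; exact/eqP.
have solvesS J J' f : J `<=` J' -> solves D g J' f -> solves D g J f.
  by move=> JJ' sf i /JJ'; exact: sf.
have [[i0]|I0] := pselect (inhabited I); last first.
  have [f [Bf _]] := hJ set0 (countable0 _).
  by exists f; split=> // i; case: I0.
(* The solution of [J] enlarged by [i] can only be the unique solution of [J]. *)
have [[J [cJ uJ]]|nu] := pselect (exists J, countable J /\
    forall f f', baire_class1 f -> baire_class1 f' ->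
    solves D g J f -> solves D g J f' -> f = f').
  have [f [Bf sf]] := hJ J cJ; exists f; split=> // i _.
  have [f' [Bf' sf']] := hJ _ (countable_setU cJ (countable1 i)).
  rewrite (uJ f f') //; first by apply: sf'; right.
  by apply: solvesS sf' => j; left.
have {}nu J : countable J -> exists f f', [/\ baire_class1 f, baire_class1 f',
    solves D g J f, solves D g J f' & exists y, (f - f') y != 0].
  move=> cJ; apply: contrapT => u; apply: nu; exists J; split=> // f f' Bf Bf' sf sf'.
  apply/funext => y; apply/eqP; rewrite -subr_eq0; apply: contrapT => /negP fy.
  by apply: u; exists f, f'; split=> //; exists y.
have /choice[bc bcP] i : exists p : R * R, forall h,
    (forall x, D i h x = 0) <-> multiplicative_shift h p.1 p.2.
  have [inj|//] := two_term_kernel (hD i).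
  have [f [f' [_ _ sf sf' [y]]]] := nu [set i] (countable1 i).
  by rewrite (inj _ (DB _ _ _ _ sf sf' _)) ?eqxx.
pose b i := (bc i).1.
have [close|far] := pselect (forall n, exists p : I * I, 0 < b p.1 - b p.2 < n.+1%:R^-1).
  have [p pP] := choice close.
  pose J := range (fun n => (p n).1) `|` range (fun n => (p n).2).
  have cJ : countable J by apply: countable_setU; exact: countable_range.
  have [f [Bf sf]] := hJ J cJ.
  exists f; split=> // i _.
  have [f1 [f2 [Bf1 Bf2 sf1 sf2 n12]]] :=
    nu _ (countable_setU cJ (countable1 i)).
  have sJ1 : solves D g J f1 by apply: solvesS sf1 => ?; left.
  have sJ2 : solves D g J f2 by apply: solvesS sf2 => ?; left.
  apply: (transfer f1); first by apply: sf1; right.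
  have [||e e0||l hl] := @proportional_of_common_shifts _ (f - f1) (f1 - f2).
  - exact: baire_class1B.
  - exact: baire_class1B.
  - have [n _ Hn] := near_infty_natSinv_lt (PosNum e0).
    have /andP[b0 bn] := pP n.
    exists (b (p n).1 - b (p n).2), ((bc (p n).1).2 / (bc (p n).2).2).
    rewrite b0 (lt_trans bn (Hn n (leqnn n))); split=> //.
    have J1 : J (p n).1 by left; exists n.
    have J2 : J (p n).2 by right; exists n.
    have shift u v : solves D g J u -> solves D g J v -> multiplicative_shift (u - v)
        (b (p n).1 - b (p n).2) ((bc (p n).1).2 / (bc (p n).2).2).
      move=> su sv; apply: multiplicative_shiftD; last apply: multiplicative_shiftN.
        exact: (bcP _ _).1 (DB _ _ _ _ su sv J1).
      exact: (bcP _ _).1 (DB _ _ _ _ su sv J2).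
    by split; exact: shift.
  - exact: n12.
  (* The difference [f1 - f2] also solves the homogeneous equation [i]. *)
  have -> : f - f1 = (fun x => l * (f1 - f2) x) by apply/funext => x; rewrite hl.
  by move=> x; rewrite two_termZ // (DB _ _ _ _ sf1 sf2) ?mulr0 //; right.
have [e e0 sep] : exists2 e : R, 0 < e &
    forall i j, `|b i - b j| < e -> b i = b j.
  move/existsNP: far => [n nn]; exists n.+1%:R^-1; first by rewrite invr_gt0.
  move=> i j ij; apply: contrapT => /eqP; rewrite neq_lt => /orP[lt|lt]; apply: nn.
    by exists (j, i); move: ij; rewrite distrC => /ltr_normlW -> /=; rewrite subr_gt0 lt.
  by exists (i, j); move: ij => /ltr_normlW -> /=; rewrite subr_gt0 lt.
(* Separated shifts are told apart by integers, one equation [rep m] being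
   chosen for each integer [m]; [i0] is the default for the integers that are
   the index of no shift. *)
pose k i := Num.floor (b i / e).
have kb i j : k i = k j -> b i = b j.
  move=> kij; apply: sep.
  have := floor_itv (b i / e); have := floor_itv (b j / e).
  rewrite -/(k i) -/(k j) kij intrD !ler_pdivlMr // !ltr_pdivrMr // mulrDl mul1r.
  move=> /andP[? ?] /andP[? ?].
  by rewrite ltr_norml; apply/andP; split; lra.
have /choice[rep repP] m : exists j, forall i, k i = m -> k j = m.
  by have [[j jm]|nj] := pselect (exists j, k j = m);
    [exists j|exists i0 => i im; case: nj; exists i].
have [f [Bf sf]] := hJ (range rep) (countable_range _).
exists f; split=> // i _; pose j := rep (k i).
have bij : b j = b i by apply: kb; apply: repP.
have [f1 [f2 [_ _ sf1 sf2 n12]]] :=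
  nu _ (countable_setU (countable1 i) (countable1 j)).
have [D12i D12j] : (forall x, D i (f1 - f2) x = 0) /\ (forall x, D j (f1 - f2) x = 0).
  by split; apply: DB sf1 sf2 _; [left|right].
(* The nonzero function [f1 - f2] forces the two multipliers to agree. *)
have cij : bc i = bc j.
  have [y y0] := n12.
  have [_ /(_ y)] := (bcP i _).1 D12i.
  have [_ /(_ y)] := (bcP j _).1 D12j.
  rewrite -/(b i) -/(b j) bij => -> /(mulIf y0) cij.
  by rewrite (surjective_pairing (bc i)) (surjective_pairing (bc j)) cij -/(b i) -/(b j) bij.
apply: (transfer f1); first by apply: sf1; left.
apply/bcP; rewrite cij; apply/bcP.
apply: (DB [set j]) => //; first by move=> _ ->; apply: sf; exists (k i).
by move=> _ ->; apply: sf1; right.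
Qed.
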